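(* Let $\phi:X\to Y$ be a map of finite sets and let $f$ be a Plott function on $X$. Then the direct image $\phi_*(f)$ is a Plott function on $Y$.
   Context: A choice function on $X$ is a map $f:2^X\to 2^X$ with $f(A)\subset A$ for all $A\subset X$ (empty values are allowed). $f$ is a Plott function if $f(A\cup B)=f(f(A)\cup B)$ for all $A,B\subset X$. For a map $\phi:X\to Y$ and a choice function $f$ on $X$, the direct image $\phi_*(f)$ is the choice function on $Y$ given by $\phi_*(f)(B)=\phi(f(\phi^{-1}(B)))$ for $B\subset Y$. *)

(* Defs.v *)
From mathcomp Require Import all_boot.

Set Implicit Arguments.
Unset Strict Implicit.
Unset Printing Implicit Defensive.

(* Empty values f A = set0 are allowed, even when A is nonempty. *)
Definition choice_function (X : finType) (f : {set X} -> {set X}) : Prop :=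
  forall A : {set X}, f A \subset A.

Definition plott_function (X : finType) (f : {set X} -> {set X}) : Prop :=
  choice_function f /\
  forall A B : {set X}, f (A :|: B) = f (f A :|: B).

Definition direct_image (X Y : finType) (phi : X -> Y)
    (f : {set X} -> {set X}) (B : {set Y}) : {set Y} :=
  phi @: f (phi @^-1: B).

(* Main.v *)
Require Import Defs.
From mathcomp Require Import all_boot.

(** Let [A'] and [B'] be the preimages of [A] and [B] under [phi], and let [C]
    be the union of the fibres that meet [f A'].  Then
    [f A' \subset C \subset A'], the second inclusion because [A'] is itself a
    union of fibres.  A Plott function does not notice the removal of unchosen
    elements ([plott_outcast]), so [f C = f A'].  By path independence [f] then
    takes the same value on [C :|: B'] as on [A' :|: B'], and the images of
    these two values under [phi] are the two sides of path independence for
    the direct image. *)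

(** The outcast property: path independence applied to [A = A :|: C] replaces
    [A] by [f A], which [C] absorbs. *)
Lemma plott_outcast {X : finType} {f : {set X} -> {set X}} {A C : {set X}} :
  plott_function f -> f A \subset C -> C \subset A -> f C = f A.
Proof.
move=> [_ fU] sfAC sCA.
by rewrite -(setUidPl sCA) fU (setUidPr sfAC).
Qed.

Theorem mainTheorem8 (X Y : finType) (phi : X -> Y)
    (f : {set X} -> {set X}) (hf : plott_function f) :
  plott_function (direct_image phi f).
Proof.
have [fsub fU] := hf.
have img_sub : choice_function (direct_image phi f).
  by move=> B; rewrite sub_imset_pre; apply: fsub.
split=> // A B; rewrite /direct_image !preimsetU; congr (phi @: _).
set C := phi @^-1: (phi @: _).
have sfC : f (phi @^-1: A) \subset C by rewrite -sub_imset_pre.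
have sCA : C \subset phi @^-1: A by apply: preimsetS; apply: img_sub.
by rewrite fU -(plott_outcast hf sfC sCA) -fU.
Qed.
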